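(* Suppose $(\Phi_1,\xi_1)$ is a minimizer of the variational problem $$\inf_{(\Phi,\xi)\in\mathbf H}\ D[\Phi]+S[\xi]\qquad\text{subject to}\quad\langle\Phi,\xi\rangle_{L^2(\mathcal F)}=1$$ with $\mathrm{Bo}=\infty$, and let $\omega_1=D[\Phi_1]+S[\xi_1]$. Then $\sqrt{\omega_1}\,\Phi_1$ is a minimizer of the variational principle for the (fundamental mode of the) mixed Steklov-Neumann eigenvalue problem $$\inf_{\Phi\in H_1}\ \int_{\mathcal D}|\nabla\Phi|^2\,dV\qquad\text{subject to}\quad\|\Phi\|_{L^2(\mathcal F)}=1,$$ where $H_1=\{\Phi\in H^1(\mathcal D):\int_{\mathcal F}\Phi\,dA=0\}$.
   Context: Setting. $\mathcal D\subset\mathbb R^3$ is a bounded, simply connected Lipschitz domain with boundary $\partial\mathcal D=\overline{\mathcal F}\cup\mathcal B$, where the free surface $\mathcal F$ is a flat bounded Lipschitz domain contained in the plane $\{z=0\}$ (the outward normal of $\mathcal D$ on $\mathcal F$ is the positive $z$-direction) and $\mathcal B=\partial\mathcal D\setminus\mathcal F$ is the wetted boundary; the container wall is vertical near $\mathcal F$, i.e. the outward unit normal of $\mathcal B$ agrees with the outward unit normal of $\partial\mathcal F$ (in the plane) on $\partial\mathcal F$. Values on $\mathcal F$ of functions in $H^1(\mathcal D)$ are understood as traces; $\langle\Phi,\xi\rangle_{L^2(\mathcal F)}=\int_{\mathcal F}\Phi\xi\,dA$. All functions are real-valued. Definitions. $$\mathbf H=\Big\{(\Phi,\xi)\in H^1(\mathcal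 D)\times H^1(\mathcal F):\int_{\mathcal F}\Phi\,dA=0=\int_{\mathcal F}\xi\,dA\Big\},\qquad D[\Phi]=\tfrac12\int_{\mathcal D}|\nabla\Phi|^2\,dV,$$ $$S[\xi]=\tfrac12\int_{\mathcal F}\Big(\xi^2+\tfrac1{\mathrm{Bo}}|\nabla_{\mathcal F}\xi|^2\Big)\,dA,\qquad \nabla_{\mathcal F}=(\partial_x,\partial_y),$$ so that for $\mathrm{Bo}=\infty$ one has $S[\xi]=\tfrac12\int_{\mathcal F}\xi^2\,dA$. The mixed Steklov-Neumann eigenvalue problem is: $\Delta\Phi=0$ in $\mathcal D$; $\partial_{\mathbf n}\Phi=0$ on $\mathcal B$; $\Phi_z=\omega^2\Phi$ on $\mathcal F$. *)

(* Defs.v *)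
From HB Require Import structures.
From mathcomp Require Import all_boot all_order all_algebra.
From mathcomp Require Import all_classical all_reals all_analysis.

Set Implicit Arguments.
Unset Strict Implicit.
Unset Printing Implicit Defensive.
Import Order.TTheory GRing.Theory Num.Theory.
Import numFieldNormedType.Exports.

Local Open Scope classical_set_scope.
Local Open Scope ring_scope.

Definition is_minimizer (R : realType) (T : Type) (J : T -> R) (A : set T)
    (x : T) : Prop :=
  A x /\ forall y, A y -> J x <= J y.

(* The library norm on [R * R] and [R * R * R] is the sup norm; it is used for
  the topology only.  Euclidean notions are expressed with [dot2] and [dot3]. *)

Section Euclidean.
Context {R : realType}.

Definition dot2 (p q : R * R) : R := p.1 * q.1 + p.2 * q.2.

Definition dot3 (p q : R * R * R) : R := dot2 p.1 q.1 + p.2 * q.2.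

Definition basis2 : seq (R * R) := [:: (1, 0); (0, 1)].

Definition ez : R * R * R := ((0, 0), 1).

Definition basis3 : seq (R * R * R) := [:: ((1, 0), 0); ((0, 1), 0); ez].

End Euclidean.

Section Domains.
Context {R : realType} {V : normedModType R} (dot : V -> V -> R).

Definition bdry (A : set V) : set V := closure A `\` A^°.

(* [gamma] only sees the component of [q - p] orthogonal to [e]: near [p] the
   set [A] is the strict subgraph, in direction [e], of a Lipschitz function on
   the hyperplane orthogonal to [e]. *)
Definition lipschitz_bdry (A : set V) : Prop :=
  forall p, bdry A p ->
  exists e, dot e e = 1 /\ exists (gamma : V -> R) (k : R),
    k.-lipschitz gamma /\
    \forall q \near p, A q <->
      dot (q - p) e < gamma (q - p - dot (q - p) e *: e).

Definition lipschitz_domain (A : set V) : Prop :=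
  [/\ A !=set0, open A, connected A & lipschitz_bdry A].

(* Based loops contract; path-connectedness is a consequence of [open] and
   [connected] when this is used. *)
Definition simply_connected (A : set V) : Prop :=
  connected A /\
  forall c : R -> V, {within `[0, 1], continuous c} ->
    (forall t, 0 <= t <= 1 -> A (c t)) -> c 0 = c 1 ->
  exists H : R * R -> V,
    [/\ {within `[0, 1] `*` `[0, 1], continuous H},
        forall s t, 0 <= s <= 1 -> 0 <= t <= 1 -> A (H (s, t)),
        forall t, 0 <= t <= 1 -> H (0, t) = c t,
        forall t, 0 <= t <= 1 -> H (1, t) = c 0 &
        forall s, 0 <= s <= 1 -> H (s, 0) = c 0 /\ H (s, 1) = c 0].

(* [nu] is the unit normal at [p] of the piece [S] of the boundary of [A],
   outward with respect to [A].  The point [p] may lie on the edge of [S],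
   where only the one-sided tangent plane of [S] is meant: [S] is tangent at
   [p] to the hyperplane orthogonal to [nu], and the side into which [nu]
   points is outside [A]. *)
Definition outward_normal (A S : set V) (p nu : V) : Prop :=
  dot nu nu = 1 /\
  forall eps : R, 0 < eps -> \forall q \near p,
    let r := eps * Num.sqrt (dot (q - p) (q - p)) in
    (S q -> `|dot (q - p) nu| <= r) /\ (r < dot (q - p) nu -> ~ A q).

End Domains.

Section Container.
Context {R : realType}.

Definition in_plane (F : set (R * R)) : set (R * R * R) :=
  [set p | F p.1 /\ p.2 = 0].

Definition wetted_bdry (D : set (R * R * R)) (F : set (R * R)) :
    set (R * R * R) :=
  bdry D `\` in_plane F.

(* Since [bdry D] is closed, the inclusion of [F] in it gives
   [bdry D = closure (in_plane F) `|` wetted_bdry D F].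
   The last condition says that the wall is vertical along the contact line,
   wherever the planar boundary of [F] has a normal. *)
Record container (D : set (R * R * R)) (F : set (R * R)) : Prop := {
  D_bounded : bounded_set D ;
  D_lipschitz : lipschitz_domain dot3 D ;
  D_simply_connected : simply_connected D ;
  F_bounded : bounded_set F ;
  F_lipschitz : lipschitz_domain dot2 F ;
  F_bdry : in_plane F `<=` bdry D ;
  F_normal : forall p, in_plane F p ->
    outward_normal dot3 D (in_plane F) p ez ;
  wall_vertical : forall p nu, bdry F p ->
    outward_normal dot2 F (bdry F) p nu ->
    outward_normal dot3 D (wetted_bdry D F) (p, 0) (nu, 0) }.

End Container.

Section C1.
Context {R : realType} {V : normedModType R} (basis : seq V).

Definition C1 (f : V -> R) : Prop :=
  continuous f /\
  forall v, v \in basis ->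
    (forall p, derivable f p v) /\ continuous (fun p => 'D_v f p).

Definition C1c (A : set V) (f : V -> R) : Prop :=
  C1 f /\ exists K, [/\ compact K, K `<=` A & forall p, ~ K p -> f p = 0].

End C1.

(* The ambient space enters only through its Lebesgue measure [mu], the class
   [test A] of compactly supported C^1 test functions in [A], and the classical
   partial derivatives [pd i], for [i] in [dirs].  As usual for first-order weak
   derivatives, testing with C^1 or with C^infinity functions is equivalent. *)
Section Sobolev.
Context {R : realType} {d : measure_display} {T : measurableType d}.
Context {I : eqType}.
Variables (mu : {measure set T -> \bar R}) (test : set T -> (T -> R) -> Prop).
Variables (dirs : seq I) (pd : I -> (T -> R) -> T -> R).

Definition L2 (A : set T) (f : T -> R) : Prop :=
  measurable_fun A f /\ mu.-integrable A (fun x => (f x ^+ 2)%:E).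

Definition is_weak_partial (A : set T) (i : I) (u g : T -> R) : Prop :=
  L2 A g /\ forall psi, test A psi ->
    \int[mu]_(x in A) (u x * pd i psi x) = - \int[mu]_(x in A) (g x * psi x).

(* A representative of the weak partial derivative; [0] if there is none. *)
Definition weak_partial (A : set T) (i : I) (u : T -> R) : T -> R :=
  xget (fun=> 0) [set g | is_weak_partial A i u g].

Definition H1 (A : set T) (u : T -> R) : Prop :=
  L2 A u /\ forall i, i \in dirs -> exists g, is_weak_partial A i u g.

Definition grad_sq (A : set T) (u : T -> R) (x : T) : R :=
  \sum_(i <- dirs) weak_partial A i u x ^+ 2.

End Sobolev.

Section Sloshing.
Context {R : realType}.
Local Notation R1 := (measurableTypeR R).
Local Notation pd2 := (fun (v : R * R) (f : R * R -> R) (p : R * R) => 'D_v f p).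
Local Notation pd3 :=
  (fun (v : R * R * R) (f : R * R * R -> R) (p : R * R * R) => 'D_v f p).

Definition area : set (R1 * R1)%type -> \bar R :=
  (@lebesgue_measure R \x @lebesgue_measure R)%E.

HB.instance Definition _ := Measure.on area.

Let area_sigma_finite : sigma_finite setT area.
Proof.
have /sigma_finiteP[F [TF ndF Foo]] := @sigma_finiteT _ _ _ (@lebesgue_measure R).
exists (fun n => F n `*` F n).
  rewrite -setXTT TF predeqE => -[x y]; split.
    move=> [/= [n _ Fnx] [k _ Gky]]; exists (maxn n k) => //; split.
    - by move: x Fnx; exact/subsetPset/ndF/leq_maxl.
    - by move: y Gky; exact/subsetPset/ndF/leq_maxr.
  by move=> [n _ []/= ? ?]; split; exists n.
move=> k; have [? ?] := Foo k; split; first exact: measurableX.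
by rewrite /area product_measure1E// lte_mul_pinfty// ge0_fin_numE.
Qed.

HB.instance Definition _ :=
  Measure_isSigmaFinite.Build _ _ _ area area_sigma_finite.

Definition volume : set (R1 * R1 * R1)%type -> \bar R :=
  (area \x @lebesgue_measure R)%E.

HB.instance Definition _ := Measure.on volume.

Definition H1_surface (F : set (R * R)) (xi : R * R -> R) : Prop :=
  H1 area (C1c basis2) basis2 pd2 F xi.

Definition grad_sq_surface (F : set (R * R)) (xi : R * R -> R) : R * R -> R :=
  grad_sq area (C1c basis2) basis2 pd2 F xi.

Definition H1_bulk (D : set (R * R * R)) (Phi : R * R * R -> R) : Prop :=
  H1 volume (C1c basis3) basis3 pd3 D Phi.

Definition weak_partial_bulk (D : set (R * R * R)) (v : R * R * R)
    (Phi : R * R * R -> R) : R * R * R -> R :=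
  weak_partial volume (C1c basis3) pd3 D v Phi.

Definition grad_sq_bulk (D : set (R * R * R)) (Phi : R * R * R -> R) :
    R * R * R -> R :=
  grad_sq volume (C1c basis3) basis3 pd3 D Phi.

Definition surface_int (F : set (R * R)) (f : R * R -> R) : R :=
  \int[area]_(p in F) f p.

(* [phi] represents the trace of [Phi] on [F]: the trace operator extends
   continuously, from H^1(D) to L^2(F), the restriction to [F] of functions that
   are C^1 up to the boundary.  By the trace theorem such a [phi] exists, and is
   unique up to null sets, for each [Phi] in H^1(D). *)
Definition is_trace (D : set (R * R * R)) (F : set (R * R))
    (Phi : R * R * R -> R) (phi : R * R -> R) : Prop :=
  [/\ H1_bulk D Phi, L2 area F phi &
  exists f : nat -> R * R * R -> R,
  [/\ forall n, C1 basis3 (f n),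
      (fun n => \int[volume]_(p in D) ((f n p - Phi p) ^+ 2)) @ \oo --> 0,
      forall v, v \in basis3 ->
        (fun n => \int[volume]_(p in D)
           (('D_v (f n) p - weak_partial_bulk D v Phi p) ^+ 2)) @ \oo --> 0 &
      (fun n => surface_int F (fun p => (f n (p, 0) - phi p) ^+ 2)) @ \oo --> 0]].

Definition dirichlet (D : set (R * R * R)) (Phi : R * R * R -> R) : R :=
  \int[volume]_(p in D) grad_sq_bulk D Phi p.

Definition kinetic (D : set (R * R * R)) (Phi : R * R * R -> R) : R :=
  2^-1 * dirichlet D Phi.

(* [Bo = +oo] gives [1 / Bo = 0]. *)
Definition surface_energy (Bo : \bar R) (F : set (R * R)) (xi : R * R -> R) : R :=
  2^-1 * surface_int F
           (fun p => xi p ^+ 2 + fine (Bo^-1)%E * grad_sq_surface F xi p).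

(* Membership of [(Phi, xi)] in the space H, [phi] being the trace of [Phi]. *)
Definition in_H (D : set (R * R * R)) (F : set (R * R))
    (Phi : R * R * R -> R) (phi xi : R * R -> R) : Prop :=
  [/\ is_trace D F Phi phi, H1_surface F xi,
      surface_int F phi = 0 & surface_int F xi = 0].

Definition sloshing_admissible (D : set (R * R * R)) (F : set (R * R)) :
    set ((R * R * R -> R) * (R * R -> R)) :=
  [set u | exists2 phi, in_H D F u.1 phi u.2 &
     surface_int F (fun p => phi p * u.2 p) = 1].

Definition sloshing_energy (Bo : \bar R) (D : set (R * R * R)) (F : set (R * R))
    (u : (R * R * R -> R) * (R * R -> R)) : R :=
  kinetic D u.1 + surface_energy Bo F u.2.

(* Membership of [Phi] in the space H_1, [phi] being the trace of [Phi]. *)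
Definition in_H_1 (D : set (R * R * R)) (F : set (R * R))
    (Phi : R * R * R -> R) (phi : R * R -> R) : Prop :=
  is_trace D F Phi phi /\ surface_int F phi = 0.

Definition steklov_neumann_admissible (D : set (R * R * R)) (F : set (R * R)) :
    set (R * R * R -> R) :=
  [set Phi | exists2 phi, in_H_1 D F Phi phi &
     Num.sqrt (surface_int F (fun p => phi p ^+ 2)) = 1].

End Sloshing.

(* Main.v *)
(** Proof idea.  Write a = ||phi1||^2, b = dirichlet Phi1, c = ||xi1||^2, where
    phi1 is the trace of Phi1, so that 2 omega1 = b + c.  Scaling minimality gives
    2 omega1 <phi, xi> <= dirichlet Phi + ||xi||^2 for every Phi with trace phi of
    mean zero and every mean-zero xi of class C^1.  The optimal choice
    xi = omega1 phi need not lie in H^1(F), but the trace is by definition the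
    L^2 limit of restrictions of C^1 functions, so it may be approximated, and
    omega1^2 ||phi||^2 <= dirichlet Phi results.  For Phi1 this reads
    omega1^2 a <= b; with a c >= 1 (Cauchy-Schwarz) and 2 omega1 = b + c it forces
    b = c = omega1 and omega1 a = 1, which is the claim.

    Scaling Phi is the delicate step, because [weak_partial] selects an arbitrary
    representative: the Dirichlet integral is homogeneous only because weak
    partial derivatives are unique almost everywhere, that is, because an
    integrable function orthogonal to all C^1 functions with compact support in an
    open set vanishes almost everywhere there. *)
Require Import Defs.
From mathcomp Require Import all_boot all_order all_algebra.
From mathcomp Require Import all_classical all_reals all_analysis.
From mathcomp Require Import measurable_realfun ring lra.

Set Implicit Arguments.
Unset Strict Implicit.
Unset Printing Implicit Defensive.
Import Order.TTheory GRing.Theory Num.Theory.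
Import numFieldNormedType.Exports.

Local Open Scope classical_set_scope.
Local Open Scope ring_scope.

(** * Borel sets of products *)

(** A countable base given by an explicit enumeration. Repeated and empty members are allowed, so
    that rational balls and products can be coded by [pickle], with [set0] at the numbers that code
    nothing. *)
Definition basis_seq (T : topologicalType) (B : nat -> set T) : Prop :=
  (forall n, open (B n)) /\
  forall (U : set T) x, open U -> U x -> exists n, B n x /\ B n `<=` U.

Lemma basis_seq_rat (R : realType) : exists B : nat -> set R, basis_seq B.
Proof.
exists (fun n => if @unpickle (rat * rat)%type n is Some cr
                 then ball (ratr cr.1 : R) (ratr cr.2) else set0); split.
  by move=> n; case: unpickle => [cr|]; [exact: ball_open|exact: open0].
move=> U x oU /mem_set xU; have [c [r [Bx BU]]] := open_subball_rat oU xU.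
by exists (pickle (c, r)); rewrite pickleK; split => //; exact/set_mem.
Qed.

Lemma basis_seq_prod (X Y : topologicalType) (A : nat -> set X)
    (B : nat -> set Y) : basis_seq A -> basis_seq B ->
  basis_seq (fun n => if @unpickle (nat * nat)%type n is Some ij
                      then A ij.1 `*` B ij.2 else set0).
Proof.
move=> [oA nA] [oB nB]; split.
  move=> n; case: unpickle => [[i j]|]; last exact: open0.
  rewrite openE => -[x y] [/= Ax By].
  by exists (A i, B j) => //; split; apply: open_nbhs_nbhs; split => //=; auto.
move=> U [x y] oU Uxy; have [[P Q] [/= + +] PQU] := open_nbhs_nbhs (conj oU Uxy).
rewrite !nbhsE => -[P' [oP' P'x] P'P] [Q' [oQ' Q'y] Q'Q].
have [i [Aix AP]] := nA _ _ oP' P'x; have [j [Bjy BQ]] := nB _ _ oQ' Q'y.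
exists (pickle (i, j)); rewrite pickleK; split => //.
by move=> -[u v] [/= Au Bv]; apply: PQU; split => /=; [exact/P'P/AP|exact/Q'Q/BQ].
Qed.

Lemma open_basis_seqE (T : topologicalType) (B : nat -> set T) (U : set T) :
  basis_seq B -> open U -> U = \bigcup_(n in [set n | B n `<=` U]) B n.
Proof.
move=> [oB nB] oU; apply/seteqP; split=> [x Ux|x [n /= BU Bx]]; last exact: BU.
by have [n [Bx BU]] := nB _ _ oU Ux; exists n.
Qed.

Section BorelProduct.
Context {R : realType}.
Local Notation R1 := (measurableTypeR R).

(** The measurable sets here are those of the product sigma-algebra. By second countability, an open
    set is a countable union of open rectangles. *)
Lemma open_measurable2 (U : set (R * R)) :
  open U -> measurable (U : set (R1 * R1)).
Proof.
have [B hB] := basis_seq_rat R; have hBB := basis_seq_prod hB hB.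
move=> oU; rewrite (open_basis_seqE hBB oU).
apply: bigcup_measurable => n _; case: unpickle => [[i j]|//].
by apply: measurableX; apply: open_measurable; exact: hB.1.
Qed.

Lemma open_measurable3 (U : set (R * R * R)) :
  open U -> measurable (U : set (R1 * R1 * R1)).
Proof.
have [B hB] := basis_seq_rat R; have hBB := basis_seq_prod hB hB.
move=> oU; rewrite (open_basis_seqE (basis_seq_prod hBB hB) oU).
apply: bigcup_measurable => n _; case: unpickle => [[i j]|//].
apply: measurableX; last by apply: open_measurable; exact: hB.1.
by apply: open_measurable2; exact: hBB.1.
Qed.

Lemma continuous_measurable2 (f : R * R -> R) (A : set (R * R)) :
  continuous f -> measurable_fun (A : set (R1 * R1)) (f : R1 * R1 -> R).
Proof.
move=> /continuousP cf; apply: measurable_funTS.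
apply: (measurability _ (RGenOpens.measurableE R)) => _ [_ [a [b ->] <-]].
by rewrite setTI; apply: open_measurable2; apply: cf; exact: interval_open.
Qed.

Lemma continuous_measurable3 (f : R * R * R -> R) (A : set (R * R * R)) :
  continuous f -> measurable_fun (A : set (R1 * R1 * R1)) (f : R1 * R1 * R1 -> R).
Proof.
move=> /continuousP cf; apply: measurable_funTS.
apply: (measurability _ (RGenOpens.measurableE R)) => _ [_ [a [b ->] <-]].
by rewrite setTI; apply: open_measurable3; apply: cf; exact: interval_open.
Qed.

(** The product sigma-algebra is contained in the Borel one because the identity map, seen as a map
    from the Borel space, has continuous coordinates. This makes the open sets a generating class
    for a Dynkin argument. *)
Lemma measurable_gen_open3 :
  @measurable _ (R1 * R1 * R1)%type = <<s @open (R * R * R)%type >>.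
Proof.
apply/seteqP; split => [E mE|]; last first.
  apply: smallest_sub; first exact: sigma_algebra_measurable.
  by move=> U; exact: open_measurable3.
pose T := g_sigma_algebraType (@open (R * R * R)%type).
have coord (f : R * R * R -> R) : continuous f ->
    measurable_fun [set: T] (f : T -> R1).
  move=> /continuousP cf; apply: (measurability _ (RGenOpens.measurableE R)).
  move=> _ [_ [a [b ->] <-]]; rewrite setTI.
  by apply: sub_sigma_algebra; apply: cf; exact: interval_open.
have mid : measurable_fun [set: T] (idfun : T -> R1 * R1 * R1).
  apply/measurable_fun_pairP; split; last by apply: coord => p; exact: cvg_snd.
  apply/measurable_fun_pairP; split; apply: coord => p.
    by apply: (cvg_comp _ _ cvg_fst cvg_fst).
  by apply: (cvg_comp _ _ cvg_fst cvg_snd).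
by have := mid measurableT _ mE; rewrite setTI preimage_id.
Qed.

End BorelProduct.

(** * Functions of class C^1 and bumps *)

Section C1Calculus.
Context {R : realType} {V : normedModType R} (basis : seq V).
Implicit Types f g : V -> R.

Lemma C1_cst (k : R) : C1 basis (fun=> k).
Proof.
split=> [x|v _]; first exact: cvg_cst.
split=> [x|]; first exact: derivable_cst.
by under eq_fun do rewrite derive_cst; move=> x; exact: cvg_cst.
Qed.

Lemma C1D f g : C1 basis f -> C1 basis g -> C1 basis (fun x => f x + g x).
Proof.
move=> [cf df] [cg dg]; split=> [x|v vb]; first by apply: cvgD; [exact: cf|exact: cg].
have [df1 df2] := df v vb; have [dg1 dg2] := dg v vb.
split=> [x|]; first exact: derivableD.
rewrite (_ : 'D_v _ = 'D_v f \+ 'D_v g); last first.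
  by apply/funext => p; exact: deriveD.
by move=> x; apply: cvgD; [exact: df2|exact: dg2].
Qed.

Lemma C1M f g : C1 basis f -> C1 basis g -> C1 basis (fun x => f x * g x).
Proof.
move=> [cf df] [cg dg]; split=> [x|v vb]; first by apply: cvgM; [exact: cf|exact: cg].
have [df1 df2] := df v vb; have [dg1 dg2] := dg v vb.
split=> [x|]; first exact: derivableM.
rewrite (_ : 'D_v _ = fun p => f p * 'D_v g p + g p * 'D_v f p); last first.
  by apply/funext => p; exact: (deriveM (df1 p) (dg1 p)).
by move=> x; apply: cvgD; apply: cvgM; [exact: cf|exact: dg2|exact: cg|exact: df2].
Qed.

Lemma C1Z (k : R) f : C1 basis f -> C1 basis (fun x => k * f x).
Proof. by move=> ?; apply: C1M => //; exact: C1_cst. Qed.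

Lemma C1N f : C1 basis f -> C1 basis (fun x => - f x).
Proof.
by move=> /(C1Z (-1)); rewrite (_ : (fun _ => _) = fun x => - f x)//;
  apply/funext => x; rewrite mulN1r.
Qed.

Lemma C1B f g : C1 basis f -> C1 basis g -> C1 basis (fun x => f x - g x).
Proof. by move=> ? ?; apply: C1D => //; exact: C1N. Qed.

Lemma C1X n f : C1 basis f -> C1 basis (fun x => f x ^+ n).
Proof.
move=> cf; elim: n => [|n IHn]; first exact: C1_cst.
by under eq_fun do rewrite exprS; exact: C1M.
Qed.

Lemma C1_prod (I : Type) (s : seq I) (f : I -> V -> R) :
  (forall i, C1 basis (f i)) -> C1 basis (fun x => \prod_(i <- s) f i x).
Proof.
move=> cf; elim: s => [|i s IHs].
  by under eq_fun do rewrite big_nil; exact: C1_cst.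
by under eq_fun do rewrite big_cons; exact: C1M.
Qed.

(** Along the line [t *: v + p] both [f] and [h \o f] become functions of one real variable, to
    which the one-dimensional chain rule applies. *)
Lemma is_derive_comp_dir (h : R -> R) f p v dh df :
  is_derive (f p) 1 h dh -> is_derive p v f df ->
  is_derive p v (h \o f) (dh * df).
Proof.
move=> hh [fd fe].
pose l : R -> R := fun t => f (t *: v + p).
have l0 : l 0 = f p by rewrite /l scale0r add0r.
have ld : is_derive (0 : R) 1 l df.
  split; first by move/derivable1P: fd.
  rewrite -fe /derive; apply: (congr1 (fun u : R -> R => lim (u @ 0^'))); apply/funext=> t /=.
  by rewrite /l addr0 scale0r add0r [_ *: 1]mulr1.
have hl : is_derive (l 0) 1 h dh by rewrite l0.
have [hd he] := is_derive1_comp hl ld.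
split; first by apply/derivable1P.
rewrite -he /derive; apply: (congr1 (fun u : R -> R => lim (u @ 0^'))); apply/funext=> t /=.
by rewrite /l addr0 scale0r add0r [_ *: 1]mulr1.
Qed.

Lemma C1_comp (h h' : R -> R) f :
  (forall t : R, is_derive t 1 h (h' t)) -> continuous h' ->
  C1 basis f -> C1 basis (fun x => h (f x)).
Proof.
move=> hh ch [cf df].
have chh : continuous h by move=> t; apply/differentiable_continuous/derivable1_diffP.
split=> [x|v vb]; first by apply: continuous_comp; [exact: cf|exact: chh].
have [df1 df2] := df v vb.
have D p : is_derive p v (h \o f) (h' (f p) * 'D_v f p).
  by apply: is_derive_comp_dir => //; exact: derivableP.
split=> [p|]; first by case: (D p).
rewrite (_ : 'D_v _ = fun p => h' (f p) * 'D_v f p); last first.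
  by apply/funext => p; apply: derive_val.
move=> x; apply: cvgM; last exact: df2.
by apply: continuous_comp; [exact: cf|exact: ch].
Qed.

Lemma C1_linear (l : {linear V -> R^o}) : continuous l -> C1 basis l.
Proof.
move=> cl; split=> // v _.
have D p : is_derive p v l (l v).
  have dl : differentiable l p by exact: linear_differentiable.
  split; first exact: diff_derivable.
  by rewrite deriveE// (diff_lin _ cl).
split=> [p|]; first by case: (D p).
by under eq_fun do rewrite derive_val; move=> x; exact: cvg_cst.
Qed.

End C1Calculus.

(** * Compactly supported bumps of class C^1 *)

Section Bumps.
Context {R : realType}.

(** Squaring the positive part removes its corner at 0, which gives a C^1 truncation. *)
Definition sqr_pos (t : R) : R := Num.max 0 t ^+ 2.

Lemma is_derive_sqr_pos (t : R) : is_derive t 1 sqr_pos (2 * Num.max 0 t).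
Proof.
(* After division by [h], this quadratic remainder bounds the error of the difference quotient by
   [|h|]. *)
have quad (h : R) : `|sqr_pos (h + t) - sqr_pos t - 2 * Num.max 0 t * h| <= h ^+ 2.
  rewrite /sqr_pos ler_norml; case: (leP 0 t) => ht; case: (leP 0 (h + t)) => hht;
    apply/andP; split; nra.
have lim : h^-1 *: ((sqr_pos \o shift t) (h *: 1) - sqr_pos t) @[h --> 0^'] -->
    2 * Num.max 0 t.
  apply/cvgrPdist_le => e e0; near=> h.
  have h0 : h != 0 by near: h; exact: nbhs_dnbhs_neq.
  have he : `|h| <= e.
    near: h; apply: dnbhs0_le => //.
  rewrite /= [h *: 1]mulr1 distrC; apply: le_trans he.
  rewrite -(ler_pM2r (_ : 0 < `|h|)) ?normr_gt0// -normrM -expr2 real_normK ?num_real//.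
  apply: le_trans (quad h); rewrite le_eqVlt; apply/orP; left; apply/eqP.
  by congr (`|_|); rewrite mulrBl [_ *: _]mulrC divfK.
by split; [apply: cvgP lim|exact: cvg_lim lim].
Unshelve. all: by end_near. Qed.

Lemma C1_sqr_pos {V : normedModType R} (basis : seq V) (f : V -> R) :
  C1 basis f -> C1 basis (fun x => sqr_pos (f x)).
Proof.
apply: C1_comp is_derive_sqr_pos _ => t.
apply: cvgM; first exact: cvg_cst.
by apply: continuous_max; [exact: cvg_cst|exact: cvg_id].
Qed.

(** A C^1 bump in one variable, centred at [a] and supported in [[a - r, a + r]]. *)
Definition hat (r a t : R) : R := sqr_pos (r - (t - a)) * sqr_pos (r + (t - a)).

Lemma hat_ge0 (r a t : R) : 0 <= hat r a t.
Proof. by rewrite mulr_ge0// sqr_ge0. Qed.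

Lemma hat_center_gt0 (r a : R) : 0 < r -> 0 < hat r a a.
Proof.
move=> r0; rewrite /hat /sqr_pos subrr subr0 addr0 mulr_gt0// exprn_gt0//.
all: by rewrite lt_max r0 orbT.
Qed.

Lemma hat_eq0 (r a t : R) : r < `|t - a| -> hat r a t = 0.
Proof.
rewrite /hat /sqr_pos; case: (ger0P (t - a)) => ta rt.
  by rewrite max_l ?expr0n ?mul0r//; lra.
by rewrite mulrC max_l ?expr0n ?mul0r//; lra.
Qed.

(** On the support both [r - (t - a)] and [r + (t - a)] lie in [[0, 2 r]], hence in [[0, 1]]. *)
Lemma hat_le1 (r a t : R) : 0 < r <= 2^-1 -> hat r a t <= 1.
Proof.
move=> /andP[r0 r1]; have [/hat_eq0 ->//|] := ltP r `|t - a|.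
rewrite ler_norml => /andP[ta1 ta2]; rewrite /hat /sqr_pos !max_r; [|lra..].
by rewrite mulr_ile1 ?sqr_ge0// exprn_ile1//; lra.
Qed.

Lemma C1_hat {V : normedModType R} (basis : seq V) (r a : R) (f : V -> R) :
  C1 basis f -> C1 basis (fun x => hat r a (f x)).
Proof.
move=> cf; have cfa : C1 basis (fun x => f x - a) by apply: C1B => //; exact: C1_cst.
by apply: C1M; apply: C1_sqr_pos; [apply: C1B|apply: C1D] => //; exact: C1_cst.
Qed.

Lemma bump3 (U : set (R * R * R)) (p : R * R * R) : open U -> U p ->
  exists b, [/\ C1c basis3 U b, forall x, 0 <= b x <= 1 & 0 < b p].
Proof.
move=> oU Up; have /nbhs_ballP[e /= e0 peU] := open_nbhs_nbhs (conj oU Up).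
(* The bump is a product of three hats supported in a closed cube of half-side [r]. The bound
   [r < e] puts the cube inside the ball, which is a cube for the sup norm; the bound by 1/2 keeps
   the values at most 1. *)
pose r := Num.min (e / 2) 2^-1.
have r0 : 0 < r by rewrite lt_min; apply/andP; split; lra.
have r1 : 0 < r <= 2^-1 by rewrite r0 ge_min lexx orbT.
have re : r < e by rewrite gt_min; apply/orP; left; lra.
exists (fun x => hat r p.1.1 x.1.1 * hat r p.1.2 x.1.2 * hat r p.2 x.2); split.
- split.
    apply: C1M; first apply: C1M.
    + apply/C1_hat/(@C1_linear _ _ _ (fst \o fst)) => x.
      exact: (cvg_comp _ _ cvg_fst cvg_fst).
    + apply/C1_hat/(@C1_linear _ _ _ (snd \o fst)) => x.
      exact: (cvg_comp _ _ cvg_fst cvg_snd).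
    + by apply/C1_hat/(@C1_linear _ _ _ snd) => x; exact: cvg_snd.
  exists (`[p.1.1 - r, p.1.1 + r] `*` `[p.1.2 - r, p.1.2 + r]
          `*` `[p.2 - r, p.2 + r]); split.
  + by apply: compact_setX; [apply: compact_setX|]; exact: segment_compact.
  + move=> x [] [] /=; rewrite !in_itv/= => h1 h2 h3; apply: peU.
    split; first split; rewrite /ball /= ltr_norml; apply/andP; split; lra.
  + move=> x; case: (ltP r `|x.1.1 - p.1.1|) => [/hat_eq0->|h1]; first by rewrite !mul0r.
    case: (ltP r `|x.1.2 - p.1.2|) => [/hat_eq0->|h2]; first by rewrite mulr0 !mul0r.
    case: (ltP r `|x.2 - p.2|) => [/hat_eq0->|h3]; first by rewrite mulr0.
    move: h1 h2 h3; rewrite !ler_norml => /andP[? ?] /andP[? ?] /andP[? ?].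
    by case; split; first split; rewrite /= in_itv/=; apply/andP; split; lra.
- move=> x; have H a t : 0 <= hat r a t <= 1 by rewrite hat_ge0 hat_le1.
  have M (u v : R) : 0 <= u <= 1 -> 0 <= v <= 1 -> 0 <= u * v <= 1.
    by move=> /andP[? ?] /andP[? ?]; rewrite mulr_ge0 ?mulr_ile1.
  exact: M (M _ _ (H _ _) (H _ _)) (H _ _).
- by apply: mulr_gt0; first apply: mulr_gt0; exact: hat_center_gt0.
Qed.

End Bumps.

(* [psi n = 1 - (\prod_(i < n) (1 - b i)) ^+ n] for countably many bumps [b i]
   whose positivity sets cover [U]. *)
Lemma bump_seq3 (R : realType) (U : set (R * R * R)) : open U ->
  exists psi : nat -> R * R * R -> R,
  [/\ forall n, C1c basis3 U (psi n), forall n x, 0 <= psi n x <= 1 &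
      forall x, psi n x @[n --> \oo] --> (\1_U x : R)].
Proof.
move=> oU; have [B1 hB1] := basis_seq_rat R.
have [B [oB nB]] : exists B : nat -> set (R * R * R), basis_seq B.
  by eexists; exact: (basis_seq_prod (basis_seq_prod hB1 hB1) hB1).
pose bump b := C1c basis3 U b /\ forall x : R * R * R, 0 <= b x <= 1.
have bump0 : bump (fun=> 0).
  split=> [|x]; last by rewrite lexx ler01.
  by split; [exact: C1_cst|exists set0; split => //; exact: compact0].
(* For each basic open set choose a bump positive on all of it, if there is one, and the zero bump
   otherwise. Only countably many bumps are thus selected. *)
have [b bP] : exists b : nat -> R * R * R -> R, forall n, bump (b n) /\
    ((exists b', bump b' /\ forall x, B n x -> 0 < b' x) ->
     forall x, B n x -> 0 < b n x).
  have bn n : exists bn, bump bn /\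
      ((exists b', bump b' /\ forall x, B n x -> 0 < b' x) ->
       forall x, B n x -> 0 < bn x).
    case: (pselect (exists b', bump b' /\ forall x, B n x -> 0 < b' x)).
      by move=> [b' [hb' Bb']]; exists b'.
    by move=> hn; exists (fun=> 0); split => // /hn.
  by exists (fun n => sval (cid (bn n))) => n; case: cid.
(* A bump positive at [x] is positive on a basic neighbourhood of [x], so the bump selected for that
   neighbourhood is positive at [x]. *)
have b_gt0 x : U x -> exists n, 0 < b n x.
  move=> Ux; have [b' [cb' b'1 b'x]] := bump3 oU Ux.
  have ob' : open [set y | 0 < b' y].
    have -> : [set y | 0 < b' y] = b' @^-1` [set t | 0 < t] by [].
    by apply: open_comp; [move=> y _; case: cb' => -[]|exact: open_gt].
  have [n [Bx Bb']] := nB _ _ ob' b'x.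
  by exists n; apply: (bP n).2 => //; exists b'; split=> [|y /Bb'].
have b01 i x : 0 <= b i x <= 1 by have [[_]] := bP i.
pose Q n x := \prod_(i <- iota 0 n) (1 - b i x).
have Q01 n x : 0 <= Q n x <= 1.
  rewrite /Q; elim: (iota 0 n) => [|i s /andP[IH1 IH2]].
    by rewrite big_nil ler01 lexx.
  by have /andP[? ?] := b01 i x; rewrite big_cons mulr_ge0 ?mulr_ile1//; lra.
exists (fun n x => 1 - Q n x ^+ n); split.
- move=> n; split.
    apply: C1B; first exact: C1_cst.
    apply: C1X; apply: C1_prod => i; apply: C1B; first exact: C1_cst.
    by have [[[]]] := bP i.
  have [K [cK KU K0]] : exists K, [/\ compact K, K `<=` U &
      forall p, ~ K p -> forall i, i \in iota 0 n -> b i p = 0].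
    elim: (iota 0 n) => [|i s [K [cK KU K0]]].
      by exists set0; split => //; exact: compact0.
    have [[[_ [Ki [cKi KiU Ki0]]] _] _] := bP i.
    exists (Ki `|` K); split; [exact: compactU|by move=> x [/KiU|/KU]|].
    move=> p /not_orP[nKi nK] j; rewrite inE => /predU1P[->|]; first exact: Ki0.
    exact: K0.
  exists K; split => // p nKp; rewrite /Q big1_seq ?expr1n ?subrr// => i /andP[_ /(K0 p nKp)->].
  by rewrite subr0.
- move=> n x; have /andP[Q0 Q1] := Q01 n x.
  have := exprn_ge0 n Q0; have := exprn_ile1 n Q0 Q1.
  by move=> ? ?; apply/andP; split; lra.
- move=> x; rewrite indicE; have [xU|xU] := boolP (x \in U); last first.
    have bx i : b i x = 0.
      have [[[_ [Ki [_ KiU Ki0]]] _] _] := bP i; apply: Ki0 => /KiU.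
      by move/mem_set; apply/negP.
    apply: cvg_near_cst; apply: nearW => n; rewrite /Q big1 ?expr1n ?subrr// => i _.
    by rewrite bx subr0.
  have [i bi] := b_gt0 x (set_mem xU).
  suff : Q n x ^+ n @[n --> \oo] --> 0.
    by move=> Q0; rewrite -[X in _ --> X]subr0; apply: cvgB => //; exact: cvg_cst.
  have /andP[_ bi1] := b01 i x.
  (* Once [n > i], the product [Q n x] contains the factor [1 - b i x < 1]; the exponent [n] then
     drives it to 0. *)
  apply: (squeeze_cvgr (f := fun=> 0) (h := fun n => (1 - b i x) ^+ n)).
  + exists i.+1 => // n /= ltin; rewrite exprn_ge0/=; last by case/andP: (Q01 n x).
    rewrite lerXn2r ?nnegrE ?subr_ge0//; first by case/andP: (Q01 n x).
    rewrite /Q (bigD1_seq i) ?mem_iota ?iota_uniq//= ler_piMr ?subr_ge0//.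
    by apply: prodr_ile1 => j _; have /andP[? ?] := b01 j x; apply/andP; split; lra.
  + exact: cvg_cst.
  + by apply: cvg_expr; rewrite ger0_norm ?subr_ge0//; lra.
Qed.

(** * Square-integrable functions and uniqueness of weak derivatives *)

(** The measurable sets on which [f] integrates to 0 form a Dynkin system. It contains the
    generating class [G], which is closed under intersection, hence it contains every measurable
    set. *)
Lemma integral_ae_eq0 {d} {T : measurableType d} {R : realType}
    (mu : {measure set T -> \bar R}) (G : set (set T)) (D : set T) (f : T -> \bar R) :
  @measurable _ T = <<s G >> -> setI_closed G -> G setT -> measurable D ->
  mu.-integrable D f -> (forall E, G E -> \int[mu]_(x in D `&` E) f x = 0)%E ->
  ae_eq mu D f (cst 0%E).
Proof.
move=> GE GI GT mD fi f0; apply: integral_ae_eq => // E ED mE.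
rewrite integral0 -(setIidr ED).
have fD A : measurable A -> mu.-integrable (D `&` A) f.
  by move=> mA; apply: integrableS fi => //; exact: measurableI.
suff : <<s G >> `<=` [set E | \int[mu]_(x in D `&` E) f x = 0]%E by apply; rewrite -GE.
move=> {E ED mE} E; apply: (dynkin_induction (G := G)) => //; first exact: f0.
(* Complements: the integral over all of [D] vanishes because [G setT], and it splits along [S]. *)
- move=> S mS /= S0; have := f0 _ GT; rewrite setIT -{1}(setUIDK D S).
  rewrite setDE integral_setU ?S0 ?add0e//; [exact: measurableI|..].
  + by apply: measurableI => //; exact: measurableC.
  + by rewrite -setDE setUIDK; exact: (measurable_int mu).
  + by apply/disj_set2P; rewrite setIACA setICr setI0.
- move=> F mF tF /= F0; rewrite setI_bigcupr integral_bigcup.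
  + by apply: eseries0 => i _ _; exact: F0.
  + exact: trivIset_setIl.
  + by move=> k; exact: measurableI.
  + by rewrite -setI_bigcupr; apply: fD; exact: bigcup_measurable.
Qed.

Section SquareIntegrable.
Context {R : realType} {d : measure_display} {T : measurableType d}.
Variables (mu : {measure set T -> \bar R}) (A : set T).
Hypothesis mA : measurable A.
Implicit Types f g : T -> R.

(** The product is dominated by [f ^+ 2 + g ^+ 2]. *)
Lemma L2_mul_integrable f g : L2 mu A f -> L2 mu A g ->
  mu.-integrable A (fun x => (f x * g x)%:E).
Proof.
move=> [mf f2] [mg g2]; apply: le_integrable (integrableD mA f2 g2) => //.
  by apply/measurable_EFinP; exact: measurable_funM.
move=> x _; rewrite -EFinD /= lee_fin [leRHS]ger0_norm ?addr_ge0 ?sqr_ge0//.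
by rewrite ler_norml; apply/andP; split; nra.
Qed.

Lemma L2D f g : L2 mu A f -> L2 mu A g -> L2 mu A (fun x => f x + g x).
Proof.
move=> hf hg; have [[mf f2] [mg g2]] := (hf, hg); split; first exact: measurable_funD.
have fg := L2_mul_integrable hf hg.
rewrite (_ : (fun x => _) =
  ((fun x => (f x ^+ 2)%:E) \+ (fun x => (g x ^+ 2)%:E)) \+
  ((fun x => (f x * g x)%:E) \+ (fun x => (f x * g x)%:E)))%E; last first.
  by apply/funext => x; rewrite /= -!EFinD; congr EFin; ring.
by do 2 apply: integrableD => //.
Qed.

Lemma L2Z k f : L2 mu A f -> L2 mu A (fun x => k * f x).
Proof.
move=> [mf f2]; split; first exact: measurable_funM.
under eq_fun do rewrite exprMn EFinM.
exact: integrableZl.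
Qed.

Lemma L2N f : L2 mu A f -> L2 mu A (fun x => - f x).
Proof. by move=> /(L2Z (-1)); under eq_fun do rewrite mulN1r. Qed.

Lemma L2B f g : L2 mu A f -> L2 mu A g -> L2 mu A (fun x => f x - g x).
Proof. by move=> ? ?; apply: L2D => //; exact: L2N. Qed.

Lemma integrable_bounded (M : R) f : (mu A < +oo)%E -> measurable_fun A f ->
  (forall x, A x -> `|f x| <= M) -> mu.-integrable A (EFin \o f).
Proof.
move=> muA mf fM; apply: measurable_bounded_integrable => //.
exists M; split; first exact: num_real.
by move=> N /ltW MN x Ax; exact: le_trans (fM x Ax) MN.
Qed.

Lemma L2_bounded (M : R) f : (mu A < +oo)%E -> measurable_fun A f ->
  (forall x, A x -> `|f x| <= M) -> L2 mu A f.
Proof.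
move=> muA mf fM; split => //; apply: (integrable_bounded (M := M ^+ 2)) => //.
  exact: measurable_funX.
by move=> x Ax; rewrite normrX lerXn2r ?nnegrE ?(le_trans _ (fM _ Ax))// fM.
Qed.

Lemma L2_cst k : (mu A < +oo)%E -> L2 mu A (fun=> k).
Proof. by move=> muA; apply: (L2_bounded (M := `|k|)). Qed.

Lemma L2_integrable f : (mu A < +oo)%E -> L2 mu A f -> mu.-integrable A (EFin \o f).
Proof.
move=> muA hf; have := L2_mul_integrable hf (L2_cst 1 muA).
by apply: eq_integrable => // x _; rewrite mulr1.
Qed.

End SquareIntegrable.

(** * The fundamental lemma of the calculus of variations *)

Section Uniqueness.
Context {R : realType}.
Local Notation R1 := (measurableTypeR R).
Implicit Types D U : set (R * R * R).

Lemma C1c_sub (V : normedModType R) (basis : seq V) (U D : set V) psi :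
  U `<=` D -> C1c basis U psi -> C1c basis D psi.
Proof.
by move=> UD [cpsi [K [cK KU K0]]]; split => //; exists K; split => // x /KU/UD.
Qed.

(** For [U] open, test functions in [D] with values in [0, 1] converge pointwise to the indicator of
    [D]&[U]. Dominated convergence, with bound [|h|], shows that [h] integrates to 0 there, and open
    sets generate the sigma-algebra. *)
Lemma orthogonal_C1c_ae_eq0 D (h : R * R * R -> R) : open D ->
  volume.-integrable D (EFin \o h) ->
  (forall psi, C1c basis3 D psi -> \int[volume]_(p in D) (h p * psi p) = 0) ->
  ae_eq volume (D : set (R1 * R1 * R1)) (EFin \o h) (cst 0%E).
Proof.
move=> oD hi h0; have mD := open_measurable3 oD.
apply: (integral_ae_eq0 measurable_gen_open3) => //.
- exact: openI.
- exact: openT.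
move=> U oU; have oDU : open (D `&` U) by exact: openI.
have [psi [psiC psi01 psi_cvg]] := bump_seq3 oDU.
have mh : measurable_fun (D : set (R1 * R1 * R1)) (h : R1 * R1 * R1 -> R).
  by apply/measurable_EFinP; exact: (measurable_int volume hi).
have mpsi n : measurable_fun (D : set (R1 * R1 * R1)) (psi n : R1 * R1 * R1 -> R).
  by apply: continuous_measurable3; case: (psiC n) => -[].
have := @dominated_convergence _ _ _ volume D mD
  (fun n x => (h x * psi n x)%:E) (fun x => (h x * \1_(D `&` U) x)%:E)
  (fun x => `|(h x)%:E|)%E.
have hpsi n : volume.-integrable D (fun x => (h x * psi n x)%:E).
  apply: le_integrable hi => //.
    by apply/measurable_EFinP; exact: measurable_funM.
  move=> x _; rewrite /= lee_fin normrM ler_piMr//.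
  by have /andP[p0 p1] := psi01 n x; rewrite ger0_norm.
case=> //.
- by move=> n; exact: (measurable_int volume (hpsi n)).
- apply/measurable_EFinP; apply: measurable_funM => //.
  by apply: measurable_indic; exact: open_measurable3.
- apply: aeW => x _; apply: cvg_EFin; first by apply: nearW.
  by apply: cvgM; [exact: cvg_cst|exact: psi_cvg].
- exact: integrable_abse.
- apply: aeW => x n _; rewrite /= lee_fin normrM ler_piMr//.
  by have /andP[p0 p1] := psi01 n x; rewrite ger0_norm.
move=> _ _ lim.
have hpsi0 n : (\int[volume]_(x in D) (h x * psi n x)%:E = 0)%E.
  rewrite -[LHS]fineK; last exact: integrable_fin_num.
  by congr EFin; apply: h0; apply: C1c_sub (psiC n); exact: subIsetl.
have : (\int[volume]_(x in D) (h x * \1_(D `&` U) x)%:E = 0)%E.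
  apply/esym; apply: cvg_unique lim => //.
  by apply: cvg_near_cst; apply: nearW => n; exact: hpsi0.
rewrite integral_mkcondr => <-; apply: eq_integral => x xD.
by rewrite patchE indicE in_setI xD /=; case: ifP => _; rewrite ?mulr1 ?mulr0.
Qed.

End Uniqueness.

Lemma continuous_pair (X Y Z : topologicalType) (f : X -> Y) (g : X -> Z) :
  continuous f -> continuous g -> continuous (fun x => (f x, g x)).
Proof.
move=> cf cg x; apply: (@cvg_pair _ _ _ _ (nbhs (f x)) (nbhs (g x))).
- exact: cf.
- exact: cg.
Qed.

(** * Bounded sets: finite measure and square-integrability of continuous functions *)

Section BoundedDomains.
Context {R : realType}.
Local Notation R1 := (measurableTypeR R).

Lemma bounded_box2 (A : set (R * R)) : bounded_set A ->
  exists M : R, 0 < M /\ A `<=` `[- M, M] `*` `[- M, M].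
Proof.
move=> [M0 [_ AM]]; exists (Num.max M0 0 + 1); split.
  by rewrite ltr_wpDl// le_max lexx orbT.
have /AM {}AM : M0 < Num.max M0 0 + 1.
  by rewrite ltr_pwDr// le_max lexx.
move=> x /AM /=; rewrite prod_normE ge_max !ler_norml => /andP[h1 h2].
by split; rewrite /= in_itv.
Qed.

Lemma bounded_box3 (A : set (R * R * R)) : bounded_set A ->
  exists M : R, 0 < M /\ A `<=` `[- M, M] `*` `[- M, M] `*` `[- M, M].
Proof.
move=> [M0 [_ AM]]; exists (Num.max M0 0 + 1); split.
  by rewrite ltr_wpDl// le_max lexx orbT.
have /AM {}AM : M0 < Num.max M0 0 + 1.
  by rewrite ltr_pwDr// le_max lexx.
move=> x /AM /=; rewrite !prod_normE !ge_max !ler_norml => /andP[/andP[h1 h2] h3].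
by split; [split|]; rewrite /= in_itv.
Qed.

Lemma compact_box2 (M : R) : compact (`[- M, M] `*` `[- M, M] : set (R * R)).
Proof. by apply: compact_setX; exact: segment_compact. Qed.

Lemma compact_box3 (M : R) :
  compact (`[- M, M] `*` `[- M, M] `*` `[- M, M] : set (R * R * R)).
Proof. by apply: compact_setX; [exact: compact_box2|exact: segment_compact]. Qed.

Lemma compact_continuous_bounded (V : normedModType R) (K : set V) (f : V -> R) :
  compact K -> continuous f -> exists M, forall x, K x -> `|f x| <= M.
Proof.
move=> cK cf.
have /compact_bounded[M [_ fM]] : compact (f @` K).
  by apply: continuous_compact => //; exact: continuous_subspaceT.
by exists (M + 1) => x Kx; apply: (fM (M + 1)); [rewrite ltrDl|exists x].
Qed.

Lemma area_bounded_lty (A : set (R * R)) : measurable (A : set (R1 * R1)) ->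
  bounded_set A -> (area A < +oo)%E.
Proof.
move=> mA /bounded_box2[M [M0 AM]].
have mB : measurable (`[- M, M] `*` `[- M, M] : set (R1 * R1)) by exact: measurableX.
apply: (@le_lt_trans _ _ (area (`[- M, M] `*` `[- M, M] : set (R1 * R1)))).
  by apply: le_measure => //; rewrite inE.
rewrite /area product_measure1E//=; apply: lte_mul_pinfty => //.
all: by rewrite lebesgue_measure_itv/=; case: ifP => // _; rewrite -EFinB ?ltry.
Qed.

Lemma volume_bounded_lty (A : set (R * R * R)) : measurable (A : set (R1 * R1 * R1)) ->
  bounded_set A -> (volume A < +oo)%E.
Proof.
move=> mA /bounded_box3[M [M0 AM]].
have mB2 : measurable (`[- M, M] `*` `[- M, M] : set (R1 * R1)) by exact: measurableX.
have mB : measurable (`[- M, M] `*` `[- M, M] `*` `[- M, M] : set (R1 * R1 * R1)).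
  exact: measurableX.
apply: (@le_lt_trans _ _ (volume (`[- M, M] `*` `[- M, M] `*` `[- M, M] : set (R1 * R1 * R1)))).
  by apply: le_measure => //; rewrite inE.
rewrite /volume product_measure1E//=; apply: lte_mul_pinfty => //.
  rewrite ge0_fin_numE//; apply: area_bounded_lty => //.
  exact/compact_bounded/compact_box2.
by rewrite lebesgue_measure_itv/=; case: ifP => // _; rewrite -EFinB ltry.
Qed.

Lemma continuous_L2_area (A : set (R * R)) (f : R * R -> R) :
  measurable (A : set (R1 * R1)) -> bounded_set A -> continuous f -> L2 area A f.
Proof.
move=> mA bA cf; have [M [M0 AM]] := bounded_box2 bA.
have [C fC] := compact_continuous_bounded (@compact_box2 M) cf.
apply: (@L2_bounded _ _ _ _ _ mA C) => //; first exact: area_bounded_lty.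
  exact: continuous_measurable2.
by move=> x /AM/fC.
Qed.

Lemma continuous_L2_volume (A : set (R * R * R)) (f : R * R * R -> R) :
  measurable (A : set (R1 * R1 * R1)) -> bounded_set A -> continuous f ->
  L2 volume A f.
Proof.
move=> mA bA cf; have [M [M0 AM]] := bounded_box3 bA.
have [C fC] := compact_continuous_bounded (@compact_box3 M) cf.
apply: (@L2_bounded _ _ _ _ _ mA C) => //; first exact: volume_bounded_lty.
  exact: continuous_measurable3.
by move=> x /AM/fC.
Qed.

End BoundedDomains.

Lemma ae_eq_Rintegral {d} {T : measurableType d} {R : realType}
    (mu : {measure set T -> \bar R}) (D : set T) (f g : T -> R) :
  measurable D -> measurable_fun D f -> measurable_fun D g ->
  ae_eq mu D (EFin \o f) (EFin \o g) ->
  \int[mu]_(x in D) f x = \int[mu]_(x in D) g x.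
Proof.
by move=> mD mf mg fg; congr fine; apply: ae_eq_integral => //; exact/measurable_EFinP.
Qed.

(** * Scaling in H^1 *)

Section Scaling.
Context {R : realType} (D : set (R * R * R)).
Hypotheses (oD : open D) (bD : bounded_set D).
Local Notation R1 := (measurableTypeR R).
Implicit Types (Phi : R * R * R -> R) (v : R * R * R).
Local Notation pd3 :=
  (fun (v : R * R * R) (f : R * R * R -> R) (p : R * R * R) => 'D_v f p).
Local Notation wp3 := (is_weak_partial volume (C1c basis3) pd3 D).

Let mD : measurable (D : set (R1 * R1 * R1)) := open_measurable3 oD.
Let fin_D := volume_bounded_lty mD bD.

Let C1_L2 (f : R * R * R -> R) : C1 basis3 f -> L2 volume D f.
Proof. by move=> [cf _]; exact: continuous_L2_volume. Qed.

Let C1_L2_derive (f : R * R * R -> R) v : v \in basis3 -> C1 basis3 f ->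
  L2 volume D (fun p => 'D_v f p).
Proof. by move=> vb [_ /(_ v vb)[_ cf]]; exact: continuous_L2_volume. Qed.

(** The difference is square-integrable, hence integrable on the bounded set [D], and it is
    orthogonal to every test function. *)
Lemma weak_partial_unique v Phi g1 g2 : wp3 v Phi g1 -> wp3 v Phi g2 ->
  ae_eq volume (D : set (R1 * R1 * R1)) (EFin \o g1) (EFin \o g2).
Proof.
move=> [Lg1 w1] [Lg2 w2].
have g12 : L2 volume D (fun p => g1 p - g2 p) by exact: L2B.
have : ae_eq volume (D : set (R1 * R1 * R1)) (EFin \o (fun p => g1 p - g2 p)) (cst 0%E).
  apply: orthogonal_C1c_ae_eq0 => //; first exact: L2_integrable.
  move=> psi cpsi; have L2psi := C1_L2 cpsi.1.
  rewrite (eq_Rintegral _ (g := fun p => g1 p * psi p - g2 p * psi p)).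
    rewrite RintegralB//; [|exact: L2_mul_integrable..].
    by apply/eqP; rewrite subr_eq0; apply/eqP/oppr_inj; rewrite -w1// -w2.
  by move=> p _; rewrite mulrBl.
apply: filterS => p /= g0 /g0 [] /eqP; rewrite subr_eq0 => /eqP.
by move=> ->.
Qed.

(** Membership in H^1 supplies a weak derivative, so [xget] does not fall back on its default 0. *)
Lemma weak_partialP v Phi : v \in basis3 -> H1_bulk D Phi ->
  wp3 v Phi (weak_partial_bulk D v Phi).
Proof.
by move=> vb [_ /(_ v vb)[g wg]]; rewrite /weak_partial_bulk /weak_partial; apply: xgetPex; exists g.
Qed.

Lemma is_weak_partialZ (t : R) v Phi g : v \in basis3 -> L2 volume D Phi ->
  wp3 v Phi g -> wp3 v (fun p => t * Phi p) (fun p => t * g p).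
Proof.
move=> vb L2Phi [L2g wg]; split=> [|psi cpsi]; first exact: L2Z.
transitivity (\int[volume]_(p in D) (t * (Phi p * 'D_v psi p))).
  by apply: eq_Rintegral => p _; rewrite mulrA.
rewrite RintegralZl//; last by apply: L2_mul_integrable => //; apply: C1_L2_derive vb cpsi.1.
rewrite (wg _ cpsi) mulrN -RintegralZl//; last by apply: L2_mul_integrable => //; exact: C1_L2 cpsi.1.
by congr (- _); apply: eq_Rintegral => p _; rewrite mulrA.
Qed.

Lemma H1_bulkZ (t : R) Phi : H1_bulk D Phi -> H1_bulk D (fun p => t * Phi p).
Proof.
move=> [L2Phi wPhi]; split=> [|v vb]; first exact: L2Z.
have [g wg] := wPhi v vb.
by exists (fun p => t * g p); exact: is_weak_partialZ.
Qed.

(** The representatives for [Phi] and for its multiple are chosen independently, so the equality is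
    only almost everywhere. *)
Lemma weak_partial_bulkZ (t : R) v Phi : v \in basis3 -> H1_bulk D Phi ->
  ae_eq volume (D : set (R1 * R1 * R1))
    (EFin \o weak_partial_bulk D v (fun p => t * Phi p))
    (EFin \o (fun p => t * weak_partial_bulk D v Phi p)).
Proof.
move=> vb H1Phi; apply: weak_partial_unique.
  by apply: weak_partialP => //; exact: H1_bulkZ.
by apply: is_weak_partialZ => //; [case: H1Phi|exact: weak_partialP].
Qed.

Lemma dirichletZ (t : R) Phi : H1_bulk D Phi ->
  dirichlet D (fun p => t * Phi p) = t ^+ 2 * dirichlet D Phi.
Proof.
move=> H1Phi.
have L2w v : v \in basis3 -> L2 volume D (weak_partial_bulk D v Phi).
  by move=> vb; case: (weak_partialP vb H1Phi).
have L2wt v : v \in basis3 -> L2 volume D (weak_partial_bulk D v (fun p => t * Phi p)).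
  by move=> vb; case: (weak_partialP vb (H1_bulkZ t H1Phi)).
(* The squared gradient is a sum of three squares; the directions stay abstract, since only their
   membership in [basis3] is used. *)
have [v1 [v2 [v3 [e1 e2 e3 gE]]]] : exists v1 v2 v3,
    [/\ v1 \in @basis3 R, v2 \in @basis3 R, v3 \in @basis3 R &
    forall Psi, grad_sq_bulk D Psi = fun p => weak_partial_bulk D v1 Psi p ^+ 2 +
      (weak_partial_bulk D v2 Psi p ^+ 2 + weak_partial_bulk D v3 Psi p ^+ 2)].
  exists (1, 0, 0), (0, 1, 0), ez; split; rewrite ?inE ?eqxx ?orbT// => Psi.
  apply/funext => p; rewrite /grad_sq_bulk /grad_sq /weak_partial_bulk.
  by rewrite big_cons big_cons big_seq1.
have mg Psi : H1_bulk D Psi -> measurable_fun (D : set (R1 * R1 * R1))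
    (grad_sq_bulk D Psi : R1 * R1 * R1 -> R).
  move=> H1Psi; rewrite gE.
  by repeat apply: measurable_funD; apply: measurable_funX;
    apply: (weak_partialP _ H1Psi).1.1.
rewrite /dirichlet.
rewrite -RintegralZl//; last first.
  have iD f g : volume.-integrable D (EFin \o f) -> volume.-integrable D (EFin \o g) ->
      volume.-integrable D (EFin \o (fun p => f p + g p)) by exact: integrableD.
  by rewrite gE; do 2 (apply: (iD); first exact: (L2w _ _).2); exact: (L2w _ _).2.
apply: ae_eq_Rintegral => //; first by apply: mg; exact: H1_bulkZ.
  by apply: measurable_funM => //; exact: mg.
have sqD (a b c : R) : (t * a) ^+ 2 + ((t * b) ^+ 2 + (t * c) ^+ 2) =
    t ^+ 2 * (a ^+ 2 + (b ^+ 2 + c ^+ 2)) by ring.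
have := weak_partial_bulkZ t e1 H1Phi; have := weak_partial_bulkZ t e2 H1Phi.
have := weak_partial_bulkZ t e3 H1Phi.
apply: filterS3 => p /= h3 h2 h1 Dp; congr EFin.
move: h3 h2 h1 => /(_ Dp)[h3] /(_ Dp)[h2] /(_ Dp)[h1].
by rewrite gE gE h1 h2 h3; exact: sqD.
Qed.

(** The multiples [t * f n] are the approximants: all three squared errors are multiplied by
    [t ^+ 2]. For the derivatives this goes through an equality almost everywhere. *)
Lemma is_traceZ (F : set (R * R)) (t : R) Phi phi :
  open F -> bounded_set F -> is_trace D F Phi phi ->
  is_trace D F (fun p => t * Phi p) (fun p => t * phi p).
Proof.
move=> oF bF [H1Phi L2phi [f [cf f1 f2 f3]]].
have mF := open_measurable2 oF.
split; [exact: H1_bulkZ|exact: L2Z|exists (fun n p => t * f n p)].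
have lim0 (u : nat -> R) : u n @[n --> \oo] --> 0 -> t ^+ 2 * u n @[n --> \oo] --> 0.
  by move=> u0; rewrite -[X in _ --> X](mulr0 (t ^+ 2)); apply: cvgM => //; exact: cvg_cst.
split.
- by move=> n; exact: C1Z.
- apply: cvg_trans (lim0 _ f1); apply: near_eq_cvg; apply: nearW => n.
  rewrite -RintegralZl//; last by apply: (L2B mD (C1_L2 (cf n)) H1Phi.1).2.
  by apply: eq_Rintegral => p _; rewrite -exprMn mulrBr.
- move=> v vb; apply: cvg_trans (lim0 _ (f2 v vb)); apply: near_eq_cvg; apply: nearW => n.
  have L2w := (weak_partialP vb H1Phi).1.
  have L2wt := (weak_partialP vb (H1_bulkZ t H1Phi)).1.
  have L2Df := C1_L2_derive vb (cf n).
  rewrite -RintegralZl//; last exact: (L2B mD L2Df L2w).2.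
  have L2tDf : L2 volume D (fun p => 'D_v (fun x => t * f n x) p).
    by apply: C1_L2_derive => //; exact: C1Z.
  apply: ae_eq_Rintegral => //.
  + by apply: measurable_funM => //; apply: measurable_funX; exact: (L2B mD L2Df L2w).1.
  + by apply: measurable_funX; exact: (L2B mD L2tDf L2wt).1.
  have := weak_partial_bulkZ t vb H1Phi.
  apply: filterS => p /= h Dp; congr EFin; have [->] := h Dp.
  have /derivableP Df : derivable (f n) p v by have [_ /(_ v vb)[]] := cf n.
  by rewrite (@deriveZ _ _ _ _ t)// -mulrBr exprMn.
- apply: cvg_trans (lim0 _ f3); apply: near_eq_cvg; apply: nearW => n.
  have L2f : L2 area F (fun p => f n (p, 0)).
    apply: continuous_L2_area => // p.
    apply: (@continuous_comp _ _ _ (fun p : R * R => (p, 0 : R)) (f n)); last exact: (cf n).1.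
    by apply: continuous_pair => q; [exact: cvg_id|exact: cvg_cst].
  rewrite /surface_int -RintegralZl//; last exact: (L2B mF L2f L2phi).2.
  by apply: eq_Rintegral => p _; rewrite -exprMn mulrBr.
Qed.

End Scaling.

(** * Integration by parts *)

Section IntegrationByParts.
Context {R : realType}.
Local Notation R1 := (measurableTypeR R).
Local Notation mu := (@lebesgue_measure R).
Local Notation pd2 := (fun (v : R * R) (f : R * R -> R) (p : R * R) => 'D_v f p).

(** The two difference quotients coincide. This serves for the embedding of the plane [z = 0] and
    for lines parallel to the axes. *)
Lemma is_derive_translate (W V : normedModType R) (f : V -> R) (c : W -> V) w v x df :
  (forall h : R, c (h *: w + x) = h *: v + c x) -> is_derive (c x) v f df ->
  is_derive x w (f \o c) df.
Proof.
move=> cE [fd <-].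
have E : (fun h : R => h^-1 *: (((f \o c) \o shift x) (h *: w) - (f \o c) x)) =
         (fun h => h^-1 *: ((f \o shift (c x)) (h *: v) - f (c x))).
  by apply/funext => h; rewrite /= cE.
by split; rewrite /derivable /derive E.
Qed.

Lemma C1_restrict_plane (f : R * R * R -> R) :
  C1 basis3 f -> C1 basis2 (fun p => f (p, 0)).
Proof.
move=> [cf df].
have cpl : continuous (fun p : R * R => (p, 0 : R)).
  by apply: continuous_pair => q; [exact: cvg_id|exact: cvg_cst].
have cpl_comp (g : R * R * R -> R) : continuous g -> continuous (fun p => g (p, 0)).
  by move=> cg p; apply: (@continuous_comp _ _ _ (fun p : R * R => (p, 0 : R)) g);
    [exact: cpl|exact: cg].
split=> [|v vb]; first exact: cpl_comp.
have v3 : (v, 0) \in @basis3 R.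
  by move: vb; rewrite !inE => /orP[/eqP->|/eqP->]; rewrite eqxx ?orbT.
have [df1 df2] := df _ v3.
have D p : is_derive p v (fun p => f (p, 0)) ('D_(v, 0) f (p, 0)).
  apply: (@is_derive_translate _ _ f (fun p : R * R => (p, 0 : R)) v (v, 0)).
    by move=> h; congr (_, _); rewrite /= [h *: _]mulr0 add0r.
  exact: derivableP.
split=> [p|]; first by case: (D p).
have -> : 'D_v (fun p => f (p, 0)) = fun p => 'D_(v, 0) f (p, 0).
  by apply/funext => p; apply: derive_val.
exact: (cpl_comp _ df2).
Qed.

Lemma integral_derive_compact_support (g g' : R -> R) (M : R) :
  (forall x : R, is_derive x 1 g (g' x)) -> continuous g' ->
  (forall x, M <= `|x| -> g x = 0) -> (forall x, M <= `|x| -> g' x = 0) ->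
  (\int[mu]_x (g' x)%:E = 0)%E.
Proof.
(* [N] is at least [M], so [g] vanishes at both endpoints, and it is positive, so [[- N, N]] is a
   nondegenerate interval whatever the sign of [M]. *)
move=> dg cg' g0 g'0; pose N := Num.max M 0 + 1.
have N0 : - N < N by rewrite gtrN// ltr_wpDl// le_max lexx orbT.
have MN : M <= N by rewrite ler_wpDr// le_max lexx.
have Npos : 0 <= N by lra.
have cg : continuous g.
  by move=> x; apply/differentiable_continuous/derivable1_diffP; case: (dg x).
transitivity (\int[mu]_(x in `[(- N)%R, N]) (g' x)%:E)%E.
  rewrite [RHS]integral_mkcond; apply: eq_integral => x _.
  rewrite patchE; case: ifPn => // /negP xN; rewrite g'0//.
  rewrite leNgt; apply/negP => xM; apply: xN; rewrite inE /= in_itv /= -ler_norml.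
  by rewrite (le_trans (ltW xM)).
rewrite (@continuous_FTC2 _ g' g) //.
- by rewrite !g0 ?normrN ?ger0_norm// subee.
- exact: continuous_subspaceT.
- by split=> [x _||]; [case: (dg x)|apply: cvg_at_right_filter; exact: cg|
    apply: cvg_at_left_filter; exact: cg].
- by move=> x _; rewrite derive1E; apply: derive_val.
Qed.

(** Extended to the whole plane, the integral is computed by Fubini, integrating first in the
    direction of [v]: each inner integral vanishes by the fundamental theorem of calculus. *)
Lemma integral_derive_C1c (F : set (R * R)) (u : R * R -> R) v :
  v \in basis2 -> C1c basis2 F u -> \int[area]_(p in F) 'D_v u p = 0.
Proof.
move=> vb [[cu du] [K [cK KF K0]]]; have [Du cDu] := du v vb.
have oK : open (~` K) by apply: closed_openC; exact: compact_closed.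
(* [K] is closed, so [u] vanishes in a whole neighbourhood of a point outside [K]. *)
have D0 p : ~ K p -> 'D_v u p = 0.
  move=> nKp; rewrite (@near_eq_derive _ _ _ u (cst 0)) ?derive_cst//.
  have : nbhs p (~` K) by exact: open_nbhs_nbhs.
  by apply: filterS => q /K0.
have [M [M0 KM]] := bounded_box2 (compact_bounded cK).
have out (x y : R) : M + 1 <= `|x| \/ M + 1 <= `|y| -> ~ K (x, y).
  move=> xyM /KM[] /=; rewrite !in_itv /= -!ler_norml => hx hy.
  by case: xyM => ?; lra.
have iD : area.-integrable setT (fun p => ('D_v u p)%:E).
  have mK : measurable (K : set (R1 * R1)).
    by rewrite -(setCK K); apply: measurableC; exact: open_measurable2.
  have [C DC] := compact_continuous_bounded cK cDu.
  have : area.-integrable K (EFin \o (fun p => 'D_v u p)).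
    apply: (@integrable_bounded _ _ _ _ _ mK C) => //.
      by apply: area_bounded_lty => //; exact: compact_bounded.
    exact: continuous_measurable2.
  rewrite integrable_mkcond//; apply: eq_integrable => // p _.
  by rewrite patchE; case: ifPn => // /negP nKp; rewrite D0// => /mem_set.
transitivity (\int[area]_p 'D_v u p).
  rewrite Rintegral_mkcond; apply: eq_Rintegral => p _.
  by rewrite patchE; case: ifPn => // /negP nFp; rewrite D0// => /KF/mem_set.
rewrite /Rintegral /area.
suff -> : (\int[(mu \x mu)%E]_p ('D_v u p)%:E = 0)%E by [].
have cD1 y : continuous (fun x => 'D_v u (x, y)).
  move=> x; apply: (@continuous_comp _ _ _ (fun x : R => (x, y)) (fun p => 'D_v u p)); last exact: cDu.
  by apply: continuous_pair => q; [exact: cvg_id|exact: cvg_cst].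
have cD2 x : continuous (fun y => 'D_v u (x, y)).
  move=> y; apply: (@continuous_comp _ _ _ (fun y : R => (x, y)) (fun p => 'D_v u p)); last exact: cDu.
  by apply: continuous_pair => q; [exact: cvg_cst|exact: cvg_id].
move: vb; rewrite !inE => /orP[/eqP vE|/eqP vE].
- rewrite -integral21_prod_meas1//; apply: integral0_eq => y _.
  apply: (@integral_derive_compact_support (fun x => u (x, y)) _ (M + 1)) => //.
  + move=> x; apply: (@is_derive_translate _ _ u (fun x => (x, y)) 1 v).
      by move=> h; rewrite vE /=; congr (_, _); rewrite /= ?[h *: _]mulr1 ?[h *: _]mulr0 ?add0r.
    exact: derivableP.
  + by move=> x hx; apply/K0/out; left.
  + by move=> x hx; apply/D0/out; left.
- rewrite -integral12_prod_meas1//; apply: integral0_eq => x _.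
  apply: (@integral_derive_compact_support (fun y => u (x, y)) _ (M + 1)) => //.
  + move=> y; apply: (@is_derive_translate _ _ u (fun y => (x, y)) 1 v).
      by move=> h; rewrite vE /=; congr (_, _); rewrite /= ?[h *: _]mulr1 ?[h *: _]mulr0 ?add0r.
    exact: derivableP.
  + by move=> y hy; apply/K0/out; right.
  + by move=> y hy; apply/D0/out; right.
Qed.

(** The classical derivative is a weak one: the derivative of [g * psi] integrates to 0 for each
    test function [psi]. *)
Lemma C1_H1_surface (F : set (R * R)) (g : R * R -> R) :
  open F -> bounded_set F -> C1 basis2 g -> H1_surface F g.
Proof.
move=> oF bF cg; have mF := open_measurable2 oF.
have L2C f : continuous f -> L2 area F f by exact: continuous_L2_area.
split=> [|v vb]; first exact/L2C/cg.1.
have [Dg cDg] := cg.2 v vb.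
exists (fun p => 'D_v g p); split=> [|psi [cpsi Kpsi]]; first exact: L2C.
have [Dpsi cDpsi] := cpsi.2 v vb.
have : \int[area]_(p in F) 'D_v (fun p => g p * psi p) p = 0.
  apply: integral_derive_C1c => //; split; first exact: C1M.
  have [K [cK KF K0]] := Kpsi.
  by exists K; split => // p /K0 ->; rewrite mulr0.
have -> : 'D_v (fun p => g p * psi p) = fun p => g p * 'D_v psi p + 'D_v g p * psi p.
  apply/funext => p; have := deriveM (Dg p) (Dpsi p).
  by rewrite [psi p *: _]mulrC.
rewrite RintegralD//; last 2 first.
- by apply: L2_mul_integrable => //; apply: L2C => //; exact: cg.1.
- by apply: L2_mul_integrable => //; apply: L2C => //; exact: cpsi.1.
by move/eqP; rewrite addr_eq0 => /eqP.
Qed.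

End IntegrationByParts.

(** * The variational argument *)

Lemma Rintegral_sqrB {d} {T : measurableType d} {R : realType}
    (mu : {measure set T -> \bar R}) (A : set T) (f g : T -> R) :
  measurable A -> L2 mu A f -> L2 mu A g ->
  \int[mu]_(x in A) ((f x - g x) ^+ 2) = \int[mu]_(x in A) (f x ^+ 2) -
    2 * \int[mu]_(x in A) (f x * g x) + \int[mu]_(x in A) (g x ^+ 2).
Proof.
move=> mA Lf Lg; have ifg := L2_mul_integrable mA Lf Lg.
have i2fg : mu.-integrable A (EFin \o (fun x => 2 * (f x * g x))).
  exact: (integrableZl mA 2 ifg).
rewrite -RintegralZl// -RintegralB//; last exact: Lf.2.
rewrite -RintegralD//; [|exact: (integrableB mA Lf.2 i2fg)|exact: Lg.2].
by apply: eq_Rintegral => x _; ring.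
Qed.

(** The algebra behind [dirichlet_lower_bound], for [g] of mean [m] on [F]. Here [w] is [omega1],
    [f] the Dirichlet integral and [b] the product [<phi, g - m>]; [a], [d], [e], [k] are the
    squared norms of [phi], [g - m], [g - phi], [m], and [c] that of [phi - (g - m)]. Eliminating
    [b] and [c] leaves a term in [k] of favourable sign. *)
Lemma mean_zero_shift (R : realType) (w a b c d e f k : R) :
  c = a - 2 * b + d -> c = e - 2 * k + k ->
  2 * w * (w * b) <= f + w ^+ 2 * d -> 0 <= w ^+ 2 * k ->
  w ^+ 2 * a <= f + w ^+ 2 * e.
Proof.
move=> h1 h2 h3 h4; have aE : a = e - k + 2 * b - d by lra.
have -> : w ^+ 2 * a = w ^+ 2 * e - w ^+ 2 * k + (2 * w * (w * b) - w ^+ 2 * d).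
  by rewrite aE; ring.
lra.
Qed.

Section Sloshing.
Context {R : realType} (D : set (R * R * R)) (F : set (R * R)).
Hypothesis DF : container D F.
Local Notation R1 := (measurableTypeR R).

Let oD : open D. Proof. by case: (D_lipschitz DF). Qed.
Let bD : bounded_set D. Proof. exact: D_bounded DF. Qed.
Let oF : open F. Proof. by case: (F_lipschitz DF). Qed.
Let bF : bounded_set F. Proof. exact: F_bounded DF. Qed.
Let mF : measurable (F : set (R1 * R1)). Proof. exact: open_measurable2. Qed.
Let fin_F : (area F < +oo)%E. Proof. exact: area_bounded_lty. Qed.

Lemma surface_energy_infinite_Bond (xi : R * R -> R) :
  surface_energy +oo%E F xi = 2^-1 * surface_int F (fun p => xi p ^+ 2).
Proof.
rewrite /surface_energy; congr (_ * _); apply: eq_Rintegral => p _.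
by rewrite invey /= mul0r addr0.
Qed.

Lemma dirichlet_ge0 (Phi : R * R * R -> R) : 0 <= dirichlet D Phi.
Proof.
by apply: Rintegral_ge0 => p _; apply: sumr_ge0 => v _; exact: sqr_ge0.
Qed.

Lemma C1_L2_surface (g : R * R -> R) : C1 basis2 g -> L2 area F g.
Proof. by move=> [cg _]; exact: continuous_L2_area. Qed.

Lemma surface_intZ (k : R) (f : R * R -> R) : area.-integrable F (EFin \o f) ->
  surface_int F (fun p => k * f p) = k * surface_int F f.
Proof. exact: RintegralZl. Qed.

Variables (Phi1 : R * R * R -> R) (xi1 : R * R -> R).
Hypothesis Hmin : is_minimizer (sloshing_energy +oo%E D F) (sloshing_admissible D F)
    (Phi1, xi1).
Let omega1 := kinetic D Phi1 + surface_energy +oo%E F xi1.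

Let omega1E : 2 * omega1 = dirichlet D Phi1 + surface_int F (fun p => xi1 p ^+ 2).
Proof. by rewrite /omega1 surface_energy_infinite_Bond /kinetic; field. Qed.

(* Apply minimality to [(t Phi, t xi)] with [t ^+ 2 * <phi, xi> = 1]. *)
Lemma sloshing_energy_lower_bound Phi phi xi : in_H_1 D F Phi phi ->
  C1 basis2 xi -> surface_int F xi = 0 ->
  2 * omega1 * surface_int F (fun p => phi p * xi p) <=
  dirichlet D Phi + surface_int F (fun p => xi p ^+ 2).
Proof.
move=> [tPhi phi0] cxi xi0; have [H1Phi Lphi _] := tPhi.
have Lxi := C1_L2_surface cxi.
set p := surface_int F (fun p => phi p * xi p).
have Ixi : 0 <= surface_int F (fun p => xi p ^+ 2).
  by apply: Rintegral_ge0 => q _; exact: sqr_ge0.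
have Ixi1 : 0 <= surface_int F (fun p => xi1 p ^+ 2).
  by apply: Rintegral_ge0 => q _; exact: sqr_ge0.
have dPhi := dirichlet_ge0 Phi; have dPhi1 := dirichlet_ge0 Phi1.
(* Scaling needs [p > 0]; otherwise the left side is nonpositive, because [omega1] is
   nonnegative. *)
have [p0|p0] := leP p 0.
  apply: le_trans (addr_ge0 dPhi Ixi).
  by apply: mulr_ge0_le0 => //; rewrite omega1E; exact: addr_ge0 dPhi1 Ixi1.
pose t := (Num.sqrt p)^-1.
have t2p : t ^+ 2 * p = 1.
  by rewrite /t exprVn sqr_sqrtr ?mulVf ?gt_eqF// ltW.
have adm : sloshing_admissible D F ((fun q => t * Phi q), (fun q => t * xi q)).
  exists (fun q => t * phi q) => /=.
    split; first exact: is_traceZ.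
    - by apply: C1_H1_surface => //; exact: C1Z.
    - by rewrite surface_intZ ?phi0 ?mulr0//; exact: L2_integrable.
    - by rewrite surface_intZ ?xi0 ?mulr0//; exact: L2_integrable.
  rewrite -t2p -surface_intZ; last exact: L2_mul_integrable.
  by apply: eq_Rintegral => q _; ring.
have : omega1 <= kinetic D (fun q => t * Phi q) +
    surface_energy +oo%E F (fun q => t * xi q) := Hmin.2 _ adm.
rewrite surface_energy_infinite_Bond /kinetic dirichletZ//.
have -> : surface_int F (fun q => (t * xi q) ^+ 2) =
    t ^+ 2 * surface_int F (fun q => xi q ^+ 2).
  by rewrite -surface_intZ; [apply: eq_Rintegral => q _; ring|exact: Lxi.2].
rewrite -!mulrDr [leRHS]mulrC ler_pdivlMr// [leLHS]mulrC.
(* Both energies carry the factor [t ^+ 2]; multiplying the goal by it turns [p] into 1. *)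
move=> H; rewrite -(ler_pM2l (_ : 0 < t ^+ 2)); last first.
  by rewrite exprn_gt0// invr_gt0 sqrtr_gt0.
have -> : t ^+ 2 * (2 * omega1 * p) = 2 * omega1 by rewrite mulrCA t2p mulr1.
exact: H.
Qed.

(** On a null set the constraint [<phi1, xi1> = 1] would read [0 = 1]. This permits division by the
    area when means are formed. *)
Lemma area_neq0 : fine (area F) != 0.
Proof.
have [[phi1 [[_ Lphi1 _] [Lxi1 _] _ _] /= I1] _] := Hmin.
apply/eqP => F0.
have {}F0 : area F = 0%E.
  by rewrite -[LHS]fineK ?F0// ge0_fin_numE.
move: I1; rewrite /surface_int /Rintegral null_set_integral//.
  by move=> /eqP; rewrite eq_sym oner_eq0.
by apply: (measurable_int area); exact: L2_mul_integrable.
Qed.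

(* The traces of the smooth approximants of [Phi], recentred to have zero mean,
   are admissible surface elevations approaching [phi] in [L^2(F)]. *)
Lemma dirichlet_lower_bound Phi phi : in_H_1 D F Phi phi ->
  omega1 ^+ 2 * surface_int F (fun p => phi p ^+ 2) <= dirichlet D Phi.
Proof.
move=> HPhi; have [tPhi phi0] := HPhi; have [H1Phi Lphi [f [cf _ _ f_phi]]] := tPhi.
set a := surface_int F (fun p => phi p ^+ 2).
pose e n := surface_int F (fun p => (f n (p, 0) - phi p) ^+ 2).
(* The error [e n] tends to 0 by the definition of the trace. *)
suff He n : omega1 ^+ 2 * a <= dirichlet D Phi + omega1 ^+ 2 * e n.
  rewrite -[leRHS]addr0 -(mulr0 (omega1 ^+ 2)).
  have lim : dirichlet D Phi + omega1 ^+ 2 * e n @[n --> \oo] -->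
      dirichlet D Phi + omega1 ^+ 2 * 0.
    by apply: cvgD; [exact: cvg_cst|apply: cvgM => //; exact: cvg_cst].
  rewrite -(cvg_lim (@Rhausdorff R) lim); apply: limr_ge; first exact: cvgP lim.
  exact: nearW.
pose g p := f n (p, 0); have cg : C1 basis2 g by exact: C1_restrict_plane.
have Lg := C1_L2_surface cg.
pose m := surface_int F g / fine (area F).
have mE : surface_int F (fun=> m) = surface_int F g.
  by rewrite /surface_int Rintegral_cst// divfK// area_neq0.
have Lm : L2 area F (fun=> m) by exact: L2_cst.
pose xi p := omega1 * (g p - m).
have cxi : C1 basis2 xi by apply: C1Z; apply: C1B => //; exact: C1_cst.
have Lgm : L2 area F (fun p => g p - m) by exact: L2B.
have Igm : surface_int F (fun p => g p - m) = 0.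
  by rewrite -[RHS](subrr (surface_int F g)) -{2}mE; apply: RintegralB => //; exact: L2_integrable.
have xi0 : surface_int F xi = 0.
  by rewrite surface_intZ ?Igm ?mulr0//; exact: L2_integrable.
have := sloshing_energy_lower_bound HPhi cxi xi0.
have -> : surface_int F (fun p => phi p * xi p) =
    omega1 * surface_int F (fun p => phi p * (g p - m)).
  rewrite -surface_intZ; last exact: L2_mul_integrable.
  by apply: eq_Rintegral => q _; rewrite /xi; ring.
have -> : surface_int F (fun p => xi p ^+ 2) =
    omega1 ^+ 2 * surface_int F (fun p => (g p - m) ^+ 2).
  rewrite -surface_intZ; last exact: Lgm.2.
  by apply: eq_Rintegral => q _; rewrite /xi; ring.
have Lgphi : L2 area F (fun p => g p - phi p) by exact: L2B.
have E1 := Rintegral_sqrB mF Lphi Lgm.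
have E2 := Rintegral_sqrB mF Lgphi Lm.
have E3 : surface_int F (fun p => (phi p - (g p - m)) ^+ 2) =
    surface_int F (fun p => (g p - phi p - m) ^+ 2).
  by apply: eq_Rintegral => q _; ring.
(* Since [phi] has mean zero, [g - phi] and [g] have the same integral. *)
have E4 : surface_int F (fun p => (g p - phi p) * m) = m * surface_int F g.
  have -> : surface_int F g = surface_int F (fun p => g p - phi p).
    by rewrite -[LHS]subr0 -phi0; apply/esym/RintegralB => //; exact: L2_integrable.
  rewrite -surface_intZ; last exact: L2_integrable.
  by apply: eq_Rintegral => q _; rewrite mulrC.
have E5 : surface_int F (fun=> m ^+ 2) = m * surface_int F g.
  by rewrite -mE -surface_intZ//; exact: L2_integrable.
have mI : 0 <= m * surface_int F g.
  by rewrite -E5; apply: Rintegral_ge0 => q _; exact: sqr_ge0.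
rewrite -!/(surface_int _ _) -/a in E1 E2 E4 E5.
move: E1 E2; rewrite E3 E4 E5 -/(e n) => E1 E2 H.
have : 0 <= omega1 ^+ 2 * (m * surface_int F g) by rewrite mulr_ge0// sqr_ge0.
exact: mean_zero_shift E1 E2 H.
Qed.

End Sloshing.

(** For [a > 0] evaluate at the minimum [s = a^-1]. For [a = 0] the expression is affine and equals
    -1 at [s = (c + 1) / 2], which is excluded. *)
Lemma discriminant_ge1 (R : realType) (a c : R) :
  0 <= a -> (forall s, 0 <= s ^+ 2 * a - 2 * s + c) -> 1 <= a * c.
Proof.
rewrite le_eqVlt => /predU1P[<-|a0] q.
  by have := q ((c + 1) / 2); rewrite mulr0; lra.
have := mulr_ge0 (ltW a0) (q a^-1).
have -> : a * (a^-1 ^+ 2 * a - 2 * a^-1 + c) = a * c - 1.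
  by field; rewrite gt_eqF.
by rewrite subr_ge0.
Qed.

Theorem corollary5p1 (R : realType) (D : set (R * R * R)) (F : set (R * R))
    (Phi1 : R * R * R -> R) (xi1 : R * R -> R) :
  container D F ->
  is_minimizer (sloshing_energy +oo%E D F) (sloshing_admissible D F)
    (Phi1, xi1) ->
  let omega1 := kinetic D Phi1 + surface_energy +oo%E F xi1 in
  is_minimizer (dirichlet D) (steklov_neumann_admissible D F)
    (fun p => Num.sqrt omega1 * Phi1 p).
Proof.
move=> DF Hmin omega1.
have oD : open D by case: (D_lipschitz DF).
have oF : open F by case: (F_lipschitz DF).
have [bD bF] := (D_bounded DF, F_bounded DF).
have mF := open_measurable2 oF.
have lower Phi phi : in_H_1 D F Phi phi ->
    omega1 ^+ 2 * surface_int F (fun p => phi p ^+ 2) <= dirichlet D Phi.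
  exact: dirichlet_lower_bound.
have [[phi1 [tPhi1 [Lxi1 _] phi10 xi10] /= phi1_xi1] _] := Hmin.
have [H1Phi1 Lphi1 _] := tPhi1.
have omega1E : 2 * omega1 = dirichlet D Phi1 + surface_int F (fun p => xi1 p ^+ 2).
  by rewrite /omega1 surface_energy_infinite_Bond /kinetic; field.
have := lower _ _ (conj tPhi1 phi10).
set a := surface_int F (fun p => phi1 p ^+ 2).
move: omega1E; set b := dirichlet D Phi1; set c := surface_int F (fun p => xi1 p ^+ 2).
move=> omega1E ab.
have a0 : 0 <= a by apply: Rintegral_ge0 => p _; exact: sqr_ge0.
have b0 : 0 <= b by exact: dirichlet_ge0.
have c0 : 0 <= c by apply: Rintegral_ge0 => p _; exact: sqr_ge0.
(* Cauchy-Schwarz, from the squared norm of [s * phi1 - xi1]; its cross term is [s] by the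
   constraint. *)
have ac : 1 <= a * c.
  apply: discriminant_ge1 => // s.
  have : 0 <= surface_int F (fun p => (s * phi1 p - xi1 p) ^+ 2).
    by apply: Rintegral_ge0 => p _; exact: sqr_ge0.
  rewrite /surface_int (Rintegral_sqrB mF (L2Z mF s Lphi1) Lxi1) -!/(surface_int _ _).
  have -> : surface_int F (fun p => (s * phi1 p) ^+ 2) = s ^+ 2 * a.
    by rewrite -(surface_intZ DF); [apply: eq_Rintegral => p _; ring|exact: Lphi1.2].
  have -> : surface_int F (fun p => s * phi1 p * xi1 p) = s.
    rewrite -[RHS]mulr1 -phi1_xi1 -(surface_intZ DF); last exact: L2_mul_integrable.
    by apply: eq_Rintegral => p _; rewrite mulrA.
  by [].
(* The chain [omega1 ^+ 2 <= omega1 ^+ 2 * (a * c) <= b * c], with [omega1] the mean of [b] and [c],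
   is the reverse of the arithmetic-geometric inequality and forces equality. *)
have bc : b = c.
  have : omega1 ^+ 2 * 1 <= omega1 ^+ 2 * (a * c) by rewrite ler_wpM2l// sqr_ge0.
  have : omega1 ^+ 2 * a * c <= b * c by rewrite ler_wpM2r.
  move=> h1 h2; have : (b - c) ^+ 2 <= 0 by nra.
  by rewrite le_eqVlt ltNge sqr_ge0 orbF sqrf_eq0 subr_eq0 => /eqP.
have cE : c = omega1 by lra.
have bE : b = omega1 by lra.
have omega1_gt0 : 0 < omega1.
  by rewrite lt_neqAle -{2}cE c0 andbT; apply/eqP => w0; move: ac; rewrite cE -w0 mulr0 ler10.
(* One inequality is [1 <= a * c] with [c = omega1]; the other is [omega1 ^+ 2 * a <= b = omega1]
   divided by [omega1]. *)
have wa : omega1 * a = 1.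
  apply/eqP; rewrite eq_le; apply/andP; split; last by rewrite mulrC -cE.
  by rewrite -(ler_pM2l omega1_gt0) mulr1 mulrA -expr2 -[leRHS]bE.
have sqw : Num.sqrt omega1 ^+ 2 = omega1 by rewrite sqr_sqrtr// ltW.
split.
  exists (fun p => Num.sqrt omega1 * phi1 p).
    split; first exact: is_traceZ.
    rewrite (surface_intZ DF) ?phi10 ?mulr0//; apply: L2_integrable => //.
    exact: area_bounded_lty.
  have -> : surface_int F (fun p => (Num.sqrt omega1 * phi1 p) ^+ 2) = omega1 * a.
    rewrite -[in RHS]sqw -(surface_intZ DF); last exact: Lphi1.2.
    by apply: eq_Rintegral => p _; rewrite exprMn.
  by rewrite wa sqrtr1.
(* For a trace of norm 1 the lower bound is [omega1 ^+ 2], which is [omega1 * b], the Dirichlet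
   integral of the scaled [Phi1]. *)
move=> Psi [psi HPsi psi1]; have := lower _ _ HPsi.
have I0 : 0 <= surface_int F (fun p => psi p ^+ 2).
  by apply: Rintegral_ge0 => p _; exact: sqr_ge0.
have sqrt1 (x : R) : 0 <= x -> Num.sqrt x = 1 -> x = 1.
  by move=> x0 x1; rewrite -(sqr_sqrtr x0) x1 expr1n.
rewrite (sqrt1 _ I0 psi1) mulr1 (dirichletZ oD bD _ H1Phi1) sqw -/b bE expr2.
exact.
Qed.
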